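(* Open Transactional Memory (OTM) meets the opacity criterion: every history $H$ describing an execution of an OTM program is opaque.
   Context: **Language.** Fix countable sets $\mathsf{Var}$ of variables $x$ and $\mathsf{Loc}$ of location names $r$, and a set $\mathsf{TrName}$ of transaction names $k,j,\dots$. Values and terms of a Haskell-like language are $V ::= r \mid \lambda x.M \mid \mathtt{return}\,M \mid M \mathbin{>\!>\!=} N \mid \mathtt{throw}\,M \mid \mathtt{catch}\,M\,N \mid \mathtt{putChar}\,c \mid \mathtt{getChar} \mid \mathtt{fork}\,M \mid \mathtt{atomic}\,M \mid \mathtt{isolated}\,M \mid \mathtt{retry} \mid M\,\mathtt{orElse}\,N \mid \mathtt{newOTVar}\,M \mid \mathtt{readOTVar}\,r \mid \mathtt{writeOTVar}\,r\,M$, and $M,N ::= x \mid V \mid M\,N \mid \dots$. The set $\mathsf{Term}$ consists of the terms well typed under Haskell conventions, with (besides $\mathtt{IO}$) two monads $\mathtt{OTM}$ (atomic, not isolated) and $\mathtt{ITM}$ (atomic and isolated): $\mathtt{atomic}:\mathtt{OTM}\,a\to\mathtt{IO}\,a$; $\mathtt{isolated}:\mathtt{ITM}\,a\to\mathtt{OTM}\,a$; $\mathtt{retry}:\mathtt{ITM}\,a$; $\mathtt{orElse}:\mathtt{ITM}\,a\to\mathtt{ITM}\,a\to\mathtt{ITM}\,a$; $\mathtt{fork}:\mathtt{OTM}\,()\to\mathtt{OTM}\,\mathtt{ThreadId}$ inside transactions (and $\mathtt{IO}\,()\to\mathtt{IO}\,\mathtt{ThreadId}$ outside); $\mathtt{newOTVar}:a\to\mathtt{ITM}(\mathtt{OTVar}\,a)$;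 $\mathtt{readOTVar}:\mathtt{OTVar}\,a\to\mathtt{ITM}\,a$; $\mathtt{writeOTVar}:\mathtt{OTVar}\,a\to a\to\mathtt{ITM}\,()$; $\mathtt{return}$, $>\!>\!=$, $\mathtt{throw}$, $\mathtt{catch}$ are available in both $\mathtt{ITM}$ and $\mathtt{OTM}$. An OTM program is a well-typed term. **States.** A thread is either $(M)_t$ (thread $t$ outside transactions evaluating $M$) or $(M;N)_{t,k}$ (thread $t$ inside transaction $k$ evaluating $M$, with continuation $N$). A thread family $P=T_{t_1}\parallel\dots\parallel T_{t_n}$ has pairwise distinct identifiers; $\parallel$ is associative and commutative. A state is $\langle P;\Sigma\rangle$ with memory $\Sigma=\langle\Theta,\Delta,\Psi\rangle$: heap $\Theta:\mathsf{Loc}\rightharpoonup\mathsf{Term}$, working memory $\Delta:\mathsf{Loc}\rightharpoonup\mathsf{Term}\times\mathsf{TrName}$ ($\Delta(r)=(M,k)$ means $r$ is claimed by $k$ with tentative value $M$), and $\Psi$ a forest on all thread identifiers (a thread forked by $t$ inside a transaction is a child of $t$). $\Sigma'$ equals $\Sigma$ except where stated. Contexts: $\mathbb E ::= [-]\mid \mathbb E \mathbin{>\!>\!=} M$; $\mathbb P_t ::= (\mathbb E)_t\parallel P$ and $\mathbb T_{t,k} ::= (\mathbb E;M)_{t,k}\parallel P$, with $t$ not in $P$. $P[k\mapsto j]$ renames $k$ to $j$ in all threads of $P$; $\Delta[k\mapsto j]$ replaces every entry $(M,k)$ by $(M,j)$. **Term reductions** $M\to N$: $M\to V$ if $M$ is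 not a value and pure evaluation of $M$ yields $V$; $\mathtt{return}\,M\mathbin{>\!>\!=}N\to N\,M$; $e\mathbin{>\!>\!=}M\to e$ for $e\in\{\mathtt{retry},\mathtt{throw}\,N\}$; $\mathtt{catch}\,e\,M\to e$ for $e\in\{\mathtt{retry},\mathtt{return}\,N\}$; $\mathtt{catch}\,(\mathtt{throw}\,M)\,N\to N\,M$. **IO transitions** ($\Theta,\Delta$ unchanged): $\mathbb P_t[\mathtt{getChar}]$ goes to $\mathbb P_t[\mathtt{return}\,c]$ with label $?c$; $\mathbb P_t[\mathtt{putChar}\,c]$ goes to $\mathbb P_t[\mathtt{return}\,()]$ with label $!c$; $\mathbb P_t[M]$ goes to $\mathbb P_t[N]$ if $M\to N$; $\mathbb P_t[\mathtt{fork}\,M]$ goes to $\mathbb P_t[\mathtt{return}\,t']\parallel(M)_{t'}$ with $t'$ fresh. **Internal transactional transitions** $\xrightarrow{\tau}$, from $\langle\mathbb T_{t,k}[\cdot];\Sigma\rangle$: - if $M\to N$, $\mathbb T_{t,k}[M]$ becomes $\mathbb T_{t,k}[N]$; - $\mathtt{fork}\,M$: becomes $\mathbb T_{t,k}[\mathtt{return}\,t']\parallel(M;\mathtt{return})_{t',k}$, $t'$ fresh, $t'$ added to $\Psi$ as child of $t$; - $\mathtt{newOTVar}\,M$: for $r\notin\mathrm{dom}(\Theta)\cup\mathrm{dom}(\Delta)$, becomes $\mathbb T_{t,k}[\mathtt{return}\,r]$ with $\Delta'=\Delta[r\mapsto(M,k)]$; - $\mathtt{readOTVar}\,r$: if $r\notin\mathrm{dom}(\Delta)$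 and $\Theta(r)=M$, becomes $\mathbb T_{t,k}[\mathtt{return}\,M]$ with $\Delta'=\Delta[r\mapsto(M,k)]$; if $\Delta(r)=(M,j)$, becomes $\mathbb T_{t,k}[\mathtt{return}\,M][k\mapsto j]$ with $\Delta'=\Delta[k\mapsto j]$; - $\mathtt{writeOTVar}\,r\,M$: if $r\notin\mathrm{dom}(\Delta)$, becomes $\mathbb T_{t,k}[\mathtt{return}\,()]$ with $\Delta'=\Delta[r\mapsto(M,k)]$; if $\Delta(r)=(N,j)$, becomes $\mathbb T_{t,k}[\mathtt{return}\,()][k\mapsto j]$ with $\Delta'=\Delta[k\mapsto j][r\mapsto(M,j)]$; - $M\,\mathtt{orElse}\,M'$: if $\langle(M;\mathtt{return})_{t,k};\Sigma\rangle\xrightarrow{\tau}{}^*\langle(\mathtt{op}\,N;\mathtt{return})_{t,j};\Sigma'\rangle$ with $\mathtt{op}\in\{\mathtt{throw},\mathtt{return}\}$, becomes $\langle\mathbb T'_{t,j}[\mathtt{op}\,N];\Sigma'\rangle$, where $\mathbb T'_{t,j}$ is $\mathbb T_{t,k}$ with the transaction renamings made by that sub-execution applied to all threads; if $\langle(M;\mathtt{return})_{t,k};\Sigma\rangle\xrightarrow{\tau}{}^*\langle(\mathtt{retry};\mathtt{return})_{t,j};\Sigma'\rangle$, becomes $\langle\mathbb T_{t,k}[M'];\Sigma\rangle$; - $\mathtt{isolated}\,M$: if $\langle(M;\mathtt{return})_{t,k};\Sigma\rangle\xrightarrow{\tau}{}^*\langle(\mathtt{op}\,N;\mathtt{return})_{t,j};\Sigma'\rangle$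 with $\mathtt{op}\in\{\mathtt{throw},\mathtt{return}\}$, becomes $\langle\mathbb T'_{t,j}[\mathtt{op}\,N];\Sigma'\rangle$, $\mathbb T'_{t,j}$ as before. When a step of a thread in $k$ accesses a location claimed by $j\ne k$, so that $k$ is renamed to $j$, we say $k$ merges into $j$. **Transaction management transitions.** Let $\mathsf{cleanup}(k,\Sigma)$ be $\Delta$ with all entries $(M,k)$ removed; $\mathsf{commit}(k,\Sigma)(r)=M$ if $\Delta(r)=(M,k)$, else $\Theta(r)$; $\mathsf{leak}(k,\Sigma)(r)=M$ if $\Theta(r)=M$, or if $\Theta(r)$ is undefined and $\Delta(r)=(M,k)$. - $\langle(\mathtt{atomic}\,M\mathbin{>\!>\!=}N)_t;\Sigma\rangle\xrightarrow{new\langle k\rangle}\langle(M;N)_{t,k};\Sigma\rangle$. - $\langle(\mathtt{return}\,M;N)_{t,k};\Sigma\rangle\xrightarrow{co\langle k\rangle}\langle(\mathtt{return}\,M\mathbin{>\!>\!=}N)_t;\Sigma'\rangle$ with $\Theta'=\mathsf{commit}(k,\Sigma)$, $\Delta'=\mathsf{cleanup}(k,\Sigma)$. - With $\Theta'=\mathsf{leak}(k,\Sigma)$, $\Delta'=\mathsf{cleanup}(k,\Sigma)$, $\rho$ the root of $t$'s tree in $\Psi$ and $\Psi'$ obtained from $\Psi$ by removing $\rho$: $\langle(\mathtt{throw}\,M;N)_{t,k};\Sigma\rangle\xrightarrow{ab\langle k,t,M\rangle}\langle(\mathtt{throw}\,M\mathbin{>\!>\!=}N)_t;\Sigma'\rangle$;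 and $\langle(M';N)_{t',k};\Sigma\rangle\xrightarrow{\overline{ab}\langle k,t,M\rangle}\langle Q;\Sigma'\rangle$, where $Q=(\mathtt{throw}\,M\mathbin{>\!>\!=}N)_{t'}$ if the root of $t'$ is $\rho$ and $Q=(\mathtt{retry})_{t'}$ otherwise. - If $\langle P;\Sigma\rangle\xrightarrow{ab\langle k,t,M\rangle}\langle P';\Sigma'\rangle$ and $\langle Q;\Sigma\rangle\xrightarrow{\overline{ab}\langle k,t,M\rangle}\langle Q';\Sigma'\rangle$ then $\langle P\parallel Q;\Sigma\rangle\xrightarrow{ab\langle k,t,M\rangle}\langle P'\parallel Q';\Sigma'\rangle$. If $P$ and $Q$ both do $co\langle k\rangle$ from $\Sigma$ to $\Sigma'$, so does $P\parallel Q$. If $\langle P;\Sigma\rangle\xrightarrow{\beta}\langle P';\Sigma'\rangle$ with $\beta\neq\tau$ a label mentioning transaction $k$ and no thread of $Q$ is in $k$, then $\langle P\parallel Q;\Sigma\rangle\xrightarrow{\beta}\langle P'\parallel Q;\Sigma'\rangle$. There is no rule for $\mathtt{retry}$: it tells the scheduler that the transaction must be re-executed from the beginning; claimed locations are released on commit, abort or restart. **Histories.** A history is a sequence of read, write, commit and abort operations, each issued by a transaction, ordered by issue time (simultaneous events arbitrarily ordered), such that no transaction issues an operation after its commit or abort. A transaction is in $H$ if it issues some operation of $H$; it is live if it has neither committed nor aborted. The history describing an execution of an OTM program (a sequence of transitions from a state with a single thread $(M)_t$ and empty $\Theta,\Delta$) records, in order, the reads and writes of locations by threads in each transaction (location creation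 counting as a write of the initial value; operations in a sub-execution discarded by $\mathtt{orElse}$ are not recorded), the commits and the aborts. Histories are extended with merges: a merge of a running transaction $k$ into a running transaction $k'$ is expressed by the sequence: take a new location $x$; $k'$ writes on $x$; $k$ reads from $x$; $k$ prepares to commit (so $k$ is commit-pending, issues no further operation and depends on $k'$), the threads of $k$ thereafter acting on behalf of $k'$. **Opacity.** $k\prec_H k'$ iff $k$ becomes committed or aborted in $H$ before $k'$ issues its first operation; $H$ is sequential if $\prec_H$ is total. $\mathit{complete}(H)$ is the set of histories obtained by adding either a commit or an abort for every live transaction in $H$. Two histories are equivalent if they contain the same transactions and each transaction issues the same operations in the same order in both. $H$ is opaque if there is a sequential history $S$ equivalent to some history in $\mathit{complete}(H)$ such that $\prec_H\subseteq\prec_S$. (The additional ''legality'' condition of Guerraoui and Kapałka's original definition is omitted, being considered relevant only in the presence of non-transactional operations, which OTM excludes.) *)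

(* Defs.v *)
From HB Require Import structures.
From mathcomp Require Import all_boot.
From mathcomp Require Import finmap.

Set Implicit Arguments.
Unset Strict Implicit.
Unset Printing Implicit Defensive.

Local Open Scope fmap_scope.

(* The three monads of OTM Haskell: IO (outside transactions), OTM (atomic,
   not isolated) and ITM (atomic and isolated). *)
Inductive monad := IO | OTM | ITM.

Inductive ty :=
| TUnit | TBool | TChar | TThreadId
| TException                       (* Haskell's SomeException *)
| TPair (A B : ty)
| TArrow (A B : ty)
| TMonad (m : monad) (A : ty)
| TOTVar (A : ty).

Section Language.

Variables (loc : countType) (tid : choiceType) (char : eqType).

(* Variables are de Bruijn indices.  The arguments of PutChar, ReadOTVar and
   WriteOTVar are arbitrary terms, as typing requires (a location is usually
   reached through a bound variable); [is_value] singles out the values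
   putChar c, readOTVar r and writeOTVar r M. *)
Inductive term :=
| Var (n : nat)
| Lam (M : term)
| App (M N : term)
| Let (M N : term)                 (* N under one binder; let-polymorphism *)
| Fix (M : term)
| Unit
| BoolLit (b : bool)
| If (M N1 N2 : term)
| CharLit (c : char)
| EqChar (M N : term)
| Pair (M N : term)
| Fst (M : term)
| Snd (M : term)
| SomeException (M : term)
| ThreadRef (t : tid)
| LocRef (r : loc)
| Return (M : term)
| Bind (M N : term)
| Throw (M : term)
| Catch (M N : term)
| PutChar (M : term)
| GetChar
| Fork (M : term)
| Atomic (M : term)
| Isolated (M : term)
| Retry
| OrElse (M N : term)
| NewOTVar (M : term)
| ReadOTVar (M : term)
| WriteOTVar (M N : term).

(* [traverse f d M] replaces each variable x of M lying under d' binders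
   (counting from d) by [f d' x]. *)
Fixpoint traverse (f : nat -> nat -> term) (d : nat) (M : term) : term :=
  match M with
  | Var n => f d n
  | Lam M => Lam (traverse f d.+1 M)
  | App M N => App (traverse f d M) (traverse f d N)
  | Let M N => Let (traverse f d M) (traverse f d.+1 N)
  | Fix M => Fix (traverse f d M)
  | Unit => Unit
  | BoolLit b => BoolLit b
  | If M N1 N2 => If (traverse f d M) (traverse f d N1) (traverse f d N2)
  | CharLit c => CharLit c
  | EqChar M N => EqChar (traverse f d M) (traverse f d N)
  | Pair M N => Pair (traverse f d M) (traverse f d N)
  | Fst M => Fst (traverse f d M)
  | Snd M => Snd (traverse f d M)
  | SomeException M => SomeException (traverse f d M)
  | ThreadRef t => ThreadRef t
  | LocRef r => LocRef r
  | Return M => Return (traverse f d M)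
  | Bind M N => Bind (traverse f d M) (traverse f d N)
  | Throw M => Throw (traverse f d M)
  | Catch M N => Catch (traverse f d M) (traverse f d N)
  | PutChar M => PutChar (traverse f d M)
  | GetChar => GetChar
  | Fork M => Fork (traverse f d M)
  | Atomic M => Atomic (traverse f d M)
  | Isolated M => Isolated (traverse f d M)
  | Retry => Retry
  | OrElse M N => OrElse (traverse f d M) (traverse f d N)
  | NewOTVar M => NewOTVar (traverse f d M)
  | ReadOTVar M => ReadOTVar (traverse f d M)
  | WriteOTVar M N => WriteOTVar (traverse f d M) (traverse f d N)
  end.

Definition shift_term (n : nat) : term -> term :=
  traverse (fun d x => Var (if d <= x then x + n else x)) 0.

(* Capture-avoiding substitution of N for variable 0. *)
Definition subst (N : term) : term -> term :=
  traverse (fun d x => if x < d then Var x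
                       else if x == d then shift_term d N else Var x.-1) 0.

(* S assigns to each location name the type of its contents. *)
Inductive has_type (S : loc -> ty) : seq ty -> term -> ty -> Prop :=
| ty_var G n A : onth G n = Some A -> has_type S G (Var n) A
| ty_lam G M A B :
    has_type S (A :: G) M B -> has_type S G (Lam M) (TArrow A B)
| ty_app G M N A B :
    has_type S G M (TArrow A B) -> has_type S G N A -> has_type S G (App M N) B
(* each use of the let-bound variable may be typed at its own instance *)
| ty_let G M N A B :
    has_type S G M A -> has_type S G (subst M N) B -> has_type S G (Let M N) B
| ty_fix G M A : has_type S G M (TArrow A A) -> has_type S G (Fix M) A
| ty_unit G : has_type S G Unit TUnit
| ty_bool G b : has_type S G (BoolLit b) TBool
| ty_if G M N1 N2 A :
    has_type S G M TBool -> has_type S G N1 A -> has_type S G N2 A ->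
    has_type S G (If M N1 N2) A
| ty_char G c : has_type S G (CharLit c) TChar
| ty_eqchar G M N :
    has_type S G M TChar -> has_type S G N TChar ->
    has_type S G (EqChar M N) TBool
| ty_pair G M N A B :
    has_type S G M A -> has_type S G N B -> has_type S G (Pair M N) (TPair A B)
| ty_fst G M A B : has_type S G M (TPair A B) -> has_type S G (Fst M) A
| ty_snd G M A B : has_type S G M (TPair A B) -> has_type S G (Snd M) B
| ty_exception G M A :
    has_type S G M A -> has_type S G (SomeException M) TException
| ty_thread G t : has_type S G (ThreadRef t) TThreadId
| ty_loc G r : has_type S G (LocRef r) (TOTVar (S r))
| ty_return G M m A : has_type S G M A -> has_type S G (Return M) (TMonad m A)
| ty_bind G M N m A B :
    has_type S G M (TMonad m A) -> has_type S G N (TArrow A (TMonad m B)) ->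
    has_type S G (Bind M N) (TMonad m B)
| ty_throw G M m A :
    has_type S G M TException -> has_type S G (Throw M) (TMonad m A)
| ty_catch G M N m A :
    has_type S G M (TMonad m A) ->
    has_type S G N (TArrow TException (TMonad m A)) ->
    has_type S G (Catch M N) (TMonad m A)
| ty_putchar G M :
    has_type S G M TChar -> has_type S G (PutChar M) (TMonad IO TUnit)
| ty_getchar G : has_type S G GetChar (TMonad IO TChar)
| ty_fork_io G M :
    has_type S G M (TMonad IO TUnit) ->
    has_type S G (Fork M) (TMonad IO TThreadId)
| ty_fork_otm G M :
    has_type S G M (TMonad OTM TUnit) ->
    has_type S G (Fork M) (TMonad OTM TThreadId)
| ty_atomic G M A :
    has_type S G M (TMonad OTM A) -> has_type S G (Atomic M) (TMonad IO A)
| ty_isolated G M A :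
    has_type S G M (TMonad ITM A) -> has_type S G (Isolated M) (TMonad OTM A)
| ty_retry G A : has_type S G Retry (TMonad ITM A)
| ty_orelse G M N A :
    has_type S G M (TMonad ITM A) -> has_type S G N (TMonad ITM A) ->
    has_type S G (OrElse M N) (TMonad ITM A)
| ty_new G M A :
    has_type S G M A -> has_type S G (NewOTVar M) (TMonad ITM (TOTVar A))
| ty_read G M A :
    has_type S G M (TOTVar A) -> has_type S G (ReadOTVar M) (TMonad ITM A)
| ty_write G M N A :
    has_type S G M (TOTVar A) -> has_type S G N A ->
    has_type S G (WriteOTVar M N) (TMonad ITM TUnit).

Definition otm_program (M : term) : Prop :=
  exists S A, has_type S [::] M A.

Definition is_value (M : term) : bool :=
  match M with
  | Var _ | App _ _ | Let _ _ | Fix _ | If _ _ _ | EqChar _ _ | Fst _ | Snd _ =>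
      false
  | PutChar (CharLit _) | ReadOTVar (LocRef _) | WriteOTVar (LocRef _) _ => true
  | PutChar _ | ReadOTVar _ | WriteOTVar _ _ => false
  | _ => true
  end.

(* Pure evaluation: call-by-name, to weak head normal form. *)
Inductive eval : term -> term -> Prop :=
| eval_value V : is_value V -> eval V V
| eval_app M N M' V :
    eval M (Lam M') -> eval (subst N M') V -> eval (App M N) V
| eval_let M N V : eval (subst M N) V -> eval (Let M N) V
| eval_fix M V : eval (App M (Fix M)) V -> eval (Fix M) V
| eval_if M N1 N2 b V :
    eval M (BoolLit b) -> eval (if b then N1 else N2) V -> eval (If M N1 N2) V
| eval_eqchar M N c d :
    eval M (CharLit c) -> eval N (CharLit d) ->
    eval (EqChar M N) (BoolLit (c == d))
| eval_fst M N1 N2 V : eval M (Pair N1 N2) -> eval N1 V -> eval (Fst M) V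
| eval_snd M N1 N2 V : eval M (Pair N1 N2) -> eval N2 V -> eval (Snd M) V
| eval_putchar M c : eval M (CharLit c) -> eval (PutChar M) (PutChar (CharLit c))
| eval_read M r : eval M (LocRef r) -> eval (ReadOTVar M) (ReadOTVar (LocRef r))
| eval_write M N r :
    eval M (LocRef r) -> eval (WriteOTVar M N) (WriteOTVar (LocRef r) N).

Inductive red : term -> term -> Prop :=
| red_eval M V : ~~ is_value M -> eval M V -> red M V
| red_bind_return M N : red (Bind (Return M) N) (App N M)
| red_bind_retry M : red (Bind Retry M) Retry
| red_bind_throw N M : red (Bind (Throw N) M) (Throw N)
| red_catch_retry M : red (Catch Retry M) Retry
| red_catch_return N M : red (Catch (Return N) M) (Return N)
| red_catch_throw M N : red (Catch (Throw M) N) (App N M).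

Inductive ectx := Hole | EBind (E : ectx) (M : term).

Fixpoint fill (E : ectx) (M : term) : term :=
  match E with
  | Hole => M
  | EBind E N => Bind (fill E M) N
  end.

Definition return_fun : term := Lam (Return (Var 0)).

(* op N with op one of throw, return *)
Definition is_result (M : term) : bool :=
  match M with Throw _ | Return _ => true | _ => false end.

Variable trname : eqType.

(* [OutTx M] is the body of the thread (M)_t, and [InTx k M N] that of (M;N)_{t,k}. *)
Inductive thread :=
| OutTx (M : term)
| InTx (k : trname) (M N : term).

(* A family of threads with pairwise distinct identifiers, up to associativity
   and commutativity of parallel composition, is a finite map; the parallel
   composition of P and Q is P + Q when their domains are disjoint, and
   P.[t <- T] with t fresh for P composes P with the single thread T_t. *)
Definition family := {fmap tid -> thread}.

Definition single (t : tid) (T : thread) : family := [fmap].[t <- T].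

Definition in_trans (k : trname) (T : thread) : Prop :=
  if T is InTx j _ _ then j = k else False.

Definition no_thread_in (k : trname) (P : family) : Prop :=
  forall t T, P.[? t] = Some T -> ~ in_trans k T.

Definition rename_thread (k j : trname) (T : thread) : thread :=
  if T is InTx i M N then InTx (if i == k then j else i) M N else T.

Definition rename_family (k j : trname) (P : family) : family :=
  [fmap t : domf P => rename_thread k j (P t)].

Definition update (K : eqType) (V : Type) (f : K -> option V) (x : K) (v : V) :
    K -> option V :=
  fun y => if y == x then Some v else f y.

(* The forest is on all thread identifiers and is given by its partial parent
   map: identifiers without a parent are roots. *)
Record memory := Memory {
  heap : loc -> option term;
  work : loc -> option (term * trname);
  parent : tid -> option tid }.

Definition set_work (S : memory) (D : loc -> option (term * trname)) : memory :=
  Memory (heap S) D (parent S).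

Definition rename_work (k j : trname) (D : loc -> option (term * trname)) :
    loc -> option (term * trname) :=
  fun r => if D r is Some (M, i) then Some (M, if i == k then j else i)
           else None.

Inductive tree_root (F : tid -> option tid) : tid -> tid -> Prop :=
| tree_root_here t : F t = None -> tree_root F t t
| tree_root_up t u rho : F t = Some u -> tree_root F u rho -> tree_root F t rho.

(* Removing a node removes its incident edges, so its children become roots. *)
Definition remove_node (rho : tid) (F : tid -> option tid) : tid -> option tid :=
  fun t => if (t == rho) || (F t == Some rho) then None else F t.

Definition cleanup (k : trname) (S : memory) : loc -> option (term * trname) :=
  fun r => if work S r is Some (M, i) then
             if i == k then None else Some (M, i)
           else None.

Definition commit (k : trname) (S : memory) : loc -> option term :=
  fun r => if work S r is Some (M, i) then
             if i == k then Some M else heap S r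
           else heap S r.

Definition leak (k : trname) (S : memory) : loc -> option term :=
  fun r => if heap S r is Some M then Some M
           else if work S r is Some (M, i) then
             if i == k then Some M else None
           else None.

Definition state := (family * memory)%type.

Inductive io_label := LGet (c : char) | LPut (c : char) | LTau.

Inductive io_step : state -> io_label -> state -> Prop :=
| io_getchar P S t E c : t \notin domf P ->
    io_step (P.[t <- OutTx (fill E GetChar)], S) (LGet c)
            (P.[t <- OutTx (fill E (Return (CharLit c)))], S)
| io_putchar P S t E c : t \notin domf P ->
    io_step (P.[t <- OutTx (fill E (PutChar (CharLit c)))], S) (LPut c)
            (P.[t <- OutTx (fill E (Return Unit))], S)
| io_red P S t E M N : t \notin domf P -> red M N ->
    io_step (P.[t <- OutTx (fill E M)], S) LTau (P.[t <- OutTx (fill E N)], S)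
| io_fork P S t E M t' : t \notin domf P -> t' \notin domf P -> t' != t ->
    io_step (P.[t <- OutTx (fill E (Fork M))], S) LTau
            (P.[t <- OutTx (fill E (Return (ThreadRef t')))].[t' <- OutTx M], S).

(* What an internal step contributes to the history: reads and writes by a
   transaction, and the merge of transaction k into transaction j. *)
Inductive event :=
| ERead (k : trname) (r : loc) (M : term)
| EWrite (k : trname) (r : loc) (M : term)
| EMerge (k j : trname).

Definition merge_event (k j : trname) : seq event :=
  if k == j then [::] else [:: EMerge k j].

(* The transaction renamings made along es, applied to all threads. *)
Definition rename_along (es : seq event) (P : family) : family :=
  foldl (fun Q e => if e is EMerge k j then rename_family k j Q else Q) P es.

(* Internal transitions, annotated with the events they contribute.  Accessing
   a location claimed by another transaction first merges k into its owner j;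
   the access is then performed on behalf of j. *)
Inductive tau_step : state -> seq event -> state -> Prop :=
| tau_red P S t k E M N L : t \notin domf P -> red M N ->
    tau_step (P.[t <- InTx k (fill E M) L], S) [::]
             (P.[t <- InTx k (fill E N) L], S)
| tau_fork P S t k E M L t' : t \notin domf P -> t' \notin domf P -> t' != t ->
    tau_step (P.[t <- InTx k (fill E (Fork M)) L], S) [::]
             (P.[t <- InTx k (fill E (Return (ThreadRef t'))) L]
               .[t' <- InTx k M return_fun],
              Memory (heap S) (work S) (update (parent S) t' t))
| tau_new P S t k E M L r : t \notin domf P ->
    heap S r = None -> work S r = None ->
    tau_step (P.[t <- InTx k (fill E (NewOTVar M)) L], S) [:: EWrite k r M]
             (P.[t <- InTx k (fill E (Return (LocRef r))) L],
              set_work S (update (work S) r (M, k)))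
| tau_read_heap P S t k E L r M : t \notin domf P ->
    work S r = None -> heap S r = Some M ->
    tau_step (P.[t <- InTx k (fill E (ReadOTVar (LocRef r))) L], S)
             [:: ERead k r M]
             (P.[t <- InTx k (fill E (Return M)) L],
              set_work S (update (work S) r (M, k)))
| tau_read_work P S t k E L r M j : t \notin domf P ->
    work S r = Some (M, j) ->
    tau_step (P.[t <- InTx k (fill E (ReadOTVar (LocRef r))) L], S)
             (rcons (merge_event k j) (ERead j r M))
             (rename_family k j P.[t <- InTx k (fill E (Return M)) L],
              set_work S (rename_work k j (work S)))
| tau_write_new P S t k E L r M : t \notin domf P ->
    work S r = None ->
    tau_step (P.[t <- InTx k (fill E (WriteOTVar (LocRef r) M)) L], S)
             [:: EWrite k r M]
             (P.[t <- InTx k (fill E (Return Unit)) L],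
              set_work S (update (work S) r (M, k)))
| tau_write_work P S t k E L r M N j : t \notin domf P ->
    work S r = Some (N, j) ->
    tau_step (P.[t <- InTx k (fill E (WriteOTVar (LocRef r) M)) L], S)
             (rcons (merge_event k j) (EWrite j r M))
             (rename_family k j P.[t <- InTx k (fill E (Return Unit)) L],
              set_work S (update (rename_work k j (work S)) r (M, j)))
| tau_orelse_result P S t k E M M' L es R j S' : t \notin domf P ->
    tau_steps (single t (InTx k M return_fun), S) es
              (single t (InTx j R return_fun), S') ->
    is_result R ->
    tau_step (P.[t <- InTx k (fill E (OrElse M M')) L], S) es
             ((rename_along es P).[t <- InTx j (fill E R) L], S')
| tau_orelse_retry P S t k E M M' L es j S' : t \notin domf P ->
    tau_steps (single t (InTx k M return_fun), S) es
              (single t (InTx j Retry return_fun), S') ->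
    tau_step (P.[t <- InTx k (fill E (OrElse M M')) L], S) [::]
             (P.[t <- InTx k (fill E M') L], S)
| tau_isolated P S t k E M L es R j S' : t \notin domf P ->
    tau_steps (single t (InTx k M return_fun), S) es
              (single t (InTx j R return_fun), S') ->
    is_result R ->
    tau_step (P.[t <- InTx k (fill E (Isolated M)) L], S) es
             ((rename_along es P).[t <- InTx j (fill E R) L], S')
with tau_steps : state -> seq event -> state -> Prop :=
| tau_refl s : tau_steps s [::] s
| tau_trans s1 es1 s2 es2 s3 :
    tau_step s1 es1 s2 -> tau_steps s2 es2 s3 -> tau_steps s1 (es1 ++ es2) s3.

Inductive mlabel :=
| New (k : trname)
| Co (k : trname)
| Ab (k : trname) (t : tid) (M : term)
| AbBar (k : trname) (t : tid) (M : term).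

Definition label_trans (b : mlabel) : trname :=
  match b with New k | Co k | Ab k _ _ | AbBar k _ _ => k end.

Definition commit_memory (k : trname) (S : memory) : memory :=
  Memory (commit k S) (cleanup k S) (parent S).

Definition abort_memory (k : trname) (rho : tid) (S : memory) : memory :=
  Memory (leak k S) (cleanup k S) (remove_node rho (parent S)).

Inductive mstep : state -> mlabel -> state -> Prop :=
| mstep_new S t M N k :
    mstep (single t (OutTx (Bind (Atomic M) N)), S) (New k)
          (single t (InTx k M N), S)
| mstep_co S t M N k :
    mstep (single t (InTx k (Return M) N), S) (Co k)
          (single t (OutTx (Bind (Return M) N)), commit_memory k S)
| mstep_ab S t M N k rho :
    tree_root (parent S) t rho ->
    mstep (single t (InTx k (Throw M) N), S) (Ab k t M)
          (single t (OutTx (Bind (Throw M) N)), abort_memory k rho S)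
| mstep_abbar_same S t M t' M' N k rho :
    tree_root (parent S) t rho -> tree_root (parent S) t' rho ->
    mstep (single t' (InTx k M' N), S) (AbBar k t M)
          (single t' (OutTx (Bind (Throw M) N)), abort_memory k rho S)
| mstep_abbar_other S t M t' M' N k rho :
    tree_root (parent S) t rho -> ~ tree_root (parent S) t' rho ->
    mstep (single t' (InTx k M' N), S) (AbBar k t M)
          (single t' (OutTx Retry), abort_memory k rho S)
| mstep_par_ab P Q P' Q' S S' k t M :
    [disjoint domf P & domf Q]%fset ->
    mstep (P, S) (Ab k t M) (P', S') -> mstep (Q, S) (AbBar k t M) (Q', S') ->
    mstep ((P + Q)%fset, S) (Ab k t M) ((P' + Q')%fset, S')
| mstep_par_co P Q P' Q' S S' k :
    [disjoint domf P & domf Q]%fset ->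
    mstep (P, S) (Co k) (P', S') -> mstep (Q, S) (Co k) (Q', S') ->
    mstep ((P + Q)%fset, S) (Co k) ((P' + Q')%fset, S')
| mstep_par P Q P' S S' b :
    [disjoint domf P & domf Q]%fset ->
    mstep (P, S) b (P', S') -> no_thread_in (label_trans b) Q ->
    mstep ((P + Q)%fset, S) b ((P' + Q)%fset, S').

Inductive action :=
| AIO (l : io_label)
| ATau (es : seq event)
| AMgmt (b : mlabel).

Inductive step : state -> action -> state -> Prop :=
| step_io s l s' : io_step s l s' -> step s (AIO l) s'
| step_tau s es s' : tau_step s es s' -> step s (ATau es) s'
| step_mgmt s b s' : mstep s b s' -> step s (AMgmt b) s'.

Inductive execution (s0 : state) : seq action -> state -> Prop :=
| exec_nil : execution s0 [::] s0
| exec_snoc acts s a s' :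
    execution s0 acts s -> step s a s' -> execution s0 (rcons acts a) s'.

Definition init (t : tid) (M : term) : state :=
  (single t (OutTx M),
   Memory (fun _ => None) (fun _ => None) (fun _ => None)).

(* The rules let the name of a finished or merged transaction be chosen again
   by a later new<k>.  The transaction itself is therefore a name together
   with the number of times that name has been started. *)
Definition transaction := (trname * nat)%type.

(* Locations of histories: those of the program, and the new ones by which
   merges are expressed. *)
Definition hloc := (loc + nat)%type.

Inductive op :=
| Read (x : hloc) (M : term)
| Write (x : hloc) (M : term)
| Prepare (k : transaction)     (* commit-pending, depending on k *)
| Commit
| Abort.

Definition op_loc (o : op) : option hloc :=
  match o with Read x _ | Write x _ => Some x | _ => None end.

Definition is_end (o : op) : bool :=
  match o with Commit | Abort => true | _ => false end.

Definition is_prepare (o : op) : bool :=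
  if o is Prepare _ then true else false.

Definition log := seq (transaction * op).

Definition issuers (H : log) : seq transaction := map fst H.

Definition ops_of (k : transaction) (H : log) : seq op :=
  [seq e.2 | e <- H & e.1 == k].

Definition new_location (x : hloc) (H : log) : bool :=
  x \notin pmap op_loc (map snd H).

(* [record_events inc H es H']: appending the events es to H yields H', where
   inc k is the current incarnation of the name k. *)
Inductive record_events (inc : trname -> nat) :
    log -> seq event -> log -> Prop :=
| rec_nil H : record_events inc H [::] H
| rec_read H k r M es H' :
    record_events inc (rcons H ((k, inc k), Read (inl r) M)) es H' ->
    record_events inc H (ERead k r M :: es) H'
| rec_write H k r M es H' :
    record_events inc (rcons H ((k, inc k), Write (inl r) M)) es H' ->
    record_events inc H (EWrite k r M :: es) H'
| rec_merge H k j n M es H' :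
    new_location (inr n) H ->
    record_events inc
      (H ++ [:: ((j, inc j), Write (inr n) M);
                ((k, inc k), Read (inr n) M);
                ((k, inc k), Prepare (j, inc j))]) es H' ->
    record_events inc H (EMerge k j :: es) H'.

Inductive describes : seq action -> (trname -> nat) -> log -> Prop :=
| desc_nil : describes [::] (fun _ => 0) [::]
| desc_io acts inc H l :
    describes acts inc H -> describes (rcons acts (AIO l)) inc H
| desc_tau acts inc H es H' :
    describes acts inc H -> record_events inc H es H' ->
    describes (rcons acts (ATau es)) inc H'
| desc_new acts inc H k :
    describes acts inc H ->
    describes (rcons acts (AMgmt (New k)))
              (fun i => if i == k then (inc i).+1 else inc i) H
| desc_co acts inc H k :
    describes acts inc H ->
    describes (rcons acts (AMgmt (Co k))) inc (rcons H ((k, inc k), Commit))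
| desc_ab acts inc H k t M :
    describes acts inc H ->
    describes (rcons acts (AMgmt (Ab k t M))) inc (rcons H ((k, inc k), Abort))
| desc_abbar acts inc H k t M :
    describes acts inc H ->
    describes (rcons acts (AMgmt (AbBar k t M))) inc
              (rcons H ((k, inc k), Abort)).

(* H describes an execution of the program M. *)
Definition history_of_program (M : term) (H : log) : Prop :=
  exists t acts s inc, execution (init t M) acts s /\ describes acts inc H.

(* No transaction issues an operation after its commit or abort; a
   commit-pending one can only be completed. *)
Definition is_history (H : log) : Prop :=
  forall H1 k o H2, H = rcons H1 (k, o) ++ H2 ->
    (is_end o -> k \notin issuers H2) /\
    (is_prepare o -> all is_end (ops_of k H2)).

Definition live (H : log) (k : transaction) : bool :=
  (k \in issuers H) && ~~ has is_end (ops_of k H).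

(* H' arises from H by inserting the entries of C, which are one commit or
   abort for each live transaction of H. *)
Definition complete (H H' : log) : Prop :=
  is_history H' /\
  exists (C : log) (m : bitseq),
    [/\ size m = size H', mask m H' = H & mask (map negb m) H' = C] /\
    [/\ uniq (issuers C), forall k, (k \in issuers C) = live H k
      & all (fun e => is_end e.2) C].

Definition prec (H : log) (k k' : transaction) : Prop :=
  exists H1 o H2,
    [/\ H = rcons H1 (k, o) ++ H2, is_end o,
        k' \notin issuers (rcons H1 (k, o)) & k' \in issuers H2].

Definition sequential (H : log) : Prop :=
  forall k k', k \in issuers H -> k' \in issuers H -> k <> k' ->
    prec H k k' \/ prec H k' k.

Definition equivalent (H H' : log) : Prop :=
  issuers H =i issuers H' /\ forall k, ops_of k H = ops_of k H'.

Definition opaque (H : log) : Prop :=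
  exists H' S, [/\ complete H H', is_history S, sequential S, equivalent S H'
                 & forall k k', prec H k k' -> prec S k k'].

End Language.

(* Main.v *)
(** Since legality is not required, a history whose transactions are well formed
    is opaque: abort the live transactions at the end, then replay transactions
    one after the other in the order in which they end.  What remains is that
    executions only produce well-formed histories, i.e. that no operation is
    ever issued on behalf of a transaction that has ended or merged.  The
    invariant is that every name in which a thread runs, or which claims a
    location, is active: commits and aborts involve all threads of the
    transaction and release its locations, and a merge renames both. *)
Require Import Defs.
From mathcomp Require Import all_boot finmap.

Set Implicit Arguments.
Unset Strict Implicit.
Unset Printing Implicit Defensive.

(** * Well-formed histories as a pairwise condition on entries *)

Section Histories.

Variables (loc : countType) (tid : choiceType) (char trname : eqType).
Notation op := (op loc tid char trname).
Notation log := (log loc tid char trname).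
Notation transaction := (transaction trname).
Local Notation Abort := (Abort loc tid char trname).
Local Notation has_ended k H :=
  (has (@is_end loc tid char trname) (ops_of k H)).
Implicit Types (H C : log) (k : transaction) (o : op).

(** The requirement of [is_history] recast as a relation between two operations of one transaction,
    so that well-formedness becomes a [pairwise] condition on logs. *)
Definition may_precede o o' : bool :=
  ~~ is_end o && (is_prepare o ==> is_end o').

Definition compatible (e e' : transaction * op) : bool :=
  (e.1 == e'.1) ==> may_precede e.2 e'.2.

Lemma ops_of_cat k H1 H2 : ops_of k (H1 ++ H2) = ops_of k H1 ++ ops_of k H2.
Proof. by rewrite /ops_of filter_cat map_cat. Qed.

Lemma ops_of_cons k e H :
  ops_of k (e :: H) = if e.1 == k then e.2 :: ops_of k H else ops_of k H.
Proof. by rewrite /ops_of /=; case: ifP. Qed.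

Lemma mem_issuers k H : (k \in issuers H) = (~~ nilp (ops_of k H)).
Proof.
elim: H => //= e H IH; rewrite inE ops_of_cons IH eq_sym.
by case: (e.1 == k).
Qed.

Lemma all_compatible e H :
  all (compatible e) H = all (may_precede e.2) (ops_of e.1 H).
Proof.
rewrite /ops_of all_map all_filter; apply: eq_all => e' /=.
by rewrite /compatible eq_sym.
Qed.

(** Only entries of the same transaction constrain each other, so well-formedness can be checked one
    transaction at a time and passes to any log with the same [ops_of]. *)
Lemma pairwise_compatibleP H :
  pairwise compatible H <-> forall k, pairwise may_precede (ops_of k H).
Proof.
elim: H => [|e H IH]; first by split.
rewrite pairwise_cons all_compatible; split=> [/andP[He /IH HH] k|HH].
  by rewrite ops_of_cons; case: eqP => [<-|//]; rewrite pairwise_cons He HH.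
apply/andP; split; first by have:= HH e.1; rewrite ops_of_cons eqxx => /andP[].
apply/IH => k; have := HH k; rewrite ops_of_cons.
by case: ifP => // _ /andP[].
Qed.

Lemma is_historyP H : is_history H <-> pairwise compatible H.
Proof.
split=> [HH|HH H1 k o H2 eH].
  (* The induction runs on suffixes with the prefix kept, because the hypothesis speaks of
     decompositions of the whole log. *)
  suff gen H2 : forall H1, H = H1 ++ H2 -> pairwise compatible H2.
    exact: (gen H [::]).
  elim: H2 => [//|[k o] H2 IH] H1 eH; rewrite pairwise_cons.
  rewrite (IH (rcons H1 (k, o))) ?cat_rcons // andbT all_compatible /=.
  have [|He Hp] := HH H1 k o H2; first by rewrite cat_rcons.
  have [eo|neo] := boolP (is_end o).
    by have := He eo; rewrite mem_issuers negbK => /nilP ->.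
  have [po|npo] := boolP (is_prepare o).
    apply: sub_all (Hp po) => o' eo'.
    by rewrite /may_precede neo po eo'.
  apply/allT => o'; by rewrite /may_precede neo (negbTE npo).
move: HH; rewrite eH cat_rcons pairwise_cat pairwise_cons all_compatible /=.
case/and3P=> _ _ /andP[HH _]; split=> [eo|po].
  rewrite mem_issuers negbK; case: (ops_of k H2) HH => // o' l.
  by rewrite /= /may_precede eo.
by apply: sub_all HH => o' /andP[_]; rewrite po.
Qed.

(** * Completion by final aborts *)

Definition completion H : log :=
  H ++ [seq (k, Abort) | k <- undup (issuers H) & live H k].

(** [undup] lists each live transaction once, so each receives exactly one abort. *)
Lemma ops_of_completion H k :
  ops_of k (completion H) =
    ops_of k H ++ (if live H k then [:: Abort] else [::]).
Proof.
rewrite /completion ops_of_cat; congr (_ ++ _).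
have -> : live H k = (k \in [seq k <- undup (issuers H) | live H k]).
  by rewrite mem_filter mem_undup andb_idr // => /andP[].
have : uniq [seq k <- undup (issuers H) | live H k].
  by rewrite filter_uniq ?undup_uniq.
elim: [seq _ <- _ | _] => // k' ks IH /= /andP[k'ks /IH {}IH].
rewrite ops_of_cons inE IH /= eq_sym; case: eqP => [->|//] /=.
by rewrite (negbTE k'ks).
Qed.

Lemma issuers_completion H : issuers (completion H) =i issuers H.
Proof.
move=> k; rewrite !mem_issuers ops_of_completion /nilp size_cat.
case: ifP => [/andP[]|]; last by rewrite addn0.
by rewrite mem_issuers /nilp; case: size.
Qed.

Lemma has_end_completion H k :
  k \in issuers H -> has_ended k (completion H).
Proof.
move=> kH; rewrite ops_of_completion has_cat /live kH /=.
by case: has.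
Qed.

Lemma complete_completion H : is_history H -> complete H (completion H).
Proof.
move=> HH; set ks := [seq k <- undup (issuers H) | live H k].
split.
  apply/is_historyP/pairwise_compatibleP => k.
  move/is_historyP/pairwise_compatibleP/(_ k): HH => HH.
  rewrite ops_of_completion pairwise_cat HH; case: ifP => [/andP[_ nend]|_] /=.
    (* An abort may follow every operation that is not an end, a prepare included, and a live
       transaction has issued no end. *)
    rewrite !andbT allrel1r; move: nend; rewrite -all_predC.
    by apply: sub_all => o /= no; rewrite /may_precede no implybT.
  by rewrite allrel0r.
exists [seq (k, Abort) | k <- ks].
exists (nseq (size H) true ++ nseq (size ks) false); split.
  rewrite !size_cat !size_nseq size_map; split=> //.
    by rewrite mask_cat ?size_nseq // mask_true // mask_false cats0.
  rewrite map_cat !map_nseq mask_cat ?size_nseq // mask_false mask_true //.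
  by rewrite size_map.
have -> : issuers [seq (k, Abort) | k <- ks] = ks.
  by rewrite /issuers -map_comp map_id_in.
split; last by rewrite all_map; apply/allP.
  by rewrite filter_uniq ?undup_uniq.
by move=> k; rewrite mem_filter mem_undup andb_idr // => /andP[].
Qed.

(** * Serialization in the order of ends *)

Definition enders H : seq transaction := issuers [seq e <- H | is_end e.2].

Lemma mem_enders k H : (k \in enders H) = has_ended k H.
Proof.
rewrite /enders; elim: H => //= e H IH; rewrite ops_of_cons.
rewrite [e.1 == k]eq_sym; case: (boolP (is_end _)) => ee /=.
  by rewrite inE IH; case: eqP => //= _; rewrite ee.
by rewrite IH; case: (k == e.1) => //=; rewrite (negbTE ee).
Qed.

(** A second end would be an operation issued after the first. *)
Lemma enders_uniq H : pairwise compatible H -> uniq (enders H).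
Proof.
rewrite /enders; elim: H => //= e H IH /andP[He /IH {}IH].
case: ifP => //= ee; rewrite IH andbT mem_issuers negbK /ops_of.
apply/nilP; move: He; rewrite all_compatible -filter_predI.
elim: {IH} H => //= e' H IH; rewrite ops_of_cons; case: eqP => //= _.
by rewrite /may_precede ee.
Qed.

Definition serialize (ks : seq transaction) H : log :=
  flatten [seq [seq e <- H | e.1 == k] | k <- ks].

Lemma ops_of_serialize ks H k : uniq ks ->
  ops_of k (serialize ks H) = if k \in ks then ops_of k H else [::].
Proof.
elim: ks => //= k' ks IH /andP[k'ks /IH {}IH].
rewrite /serialize /= ops_of_cat IH inE eq_sym /ops_of -filter_predI.
case: (eqVneq k' k) => [<-|ne] /=.
  rewrite (negbTE k'ks) cats0; congr map; apply: eq_filter => e /=.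
  by rewrite andbb.
rewrite (@eq_filter _ _ pred0) ?filter_pred0 // => e /=.
by apply/andP => -[/eqP-> /eqP ekk']; rewrite ekk' eqxx in ne.
Qed.

Lemma issuers_serialize ks H : uniq ks ->
  issuers (serialize ks H) =i [pred k | (k \in ks) && (k \in issuers H)].
Proof.
move=> uks k; rewrite !mem_issuers ops_of_serialize // inE mem_issuers.
by case: ifP.
Qed.

(** Nothing follows an end in a well-formed log, so each block of [serialize] belonging to an ended
    transaction closes with its end. *)
Lemma rcons_end H k : pairwise compatible H -> has_ended k H ->
  exists B o, [seq e <- H | e.1 == k] = rcons B (k, o) /\ is_end o.
Proof.
move=> HH; have /(pairwise_filter (fun e => e.1 == k)) := HH.
rewrite /ops_of has_map; have := filter_all (fun e => e.1 == k) H.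
case/lastP: [seq _ <- _ | _] => // B [k' o]; rewrite all_rcons /=.
case/andP=> /eqP -> aB; rewrite pairwise_rcons has_rcons /= => /andP[cB _] hB.
exists B, o; split=> //; case/orP: hB => //.
elim: B aB cB => //= e B IH /andP[/eqP ek aB] /andP[+ cB] /orP[|/(IH aB cB)//].
by rewrite /compatible ek eqxx /may_precede /= => /andP[/negbTE ->].
Qed.

Lemma prec_serialize ks1 k ks2 H k' :
  uniq (ks1 ++ k :: ks2) -> pairwise compatible H ->
  has_ended k H -> k' \in ks2 -> k' \in issuers H ->
  prec (serialize (ks1 ++ k :: ks2) H) k k'.
Proof.
move=> uks HH kend k'ks2 k'H; have [B [o [eB eo]]] := rcons_end HH kend.
(* The split point is the end closing the block of [k]; by uniqueness, the blocks up to it contain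
   nothing of [k']. *)
exists (serialize ks1 H ++ B), o, (serialize ks2 H).
have eS : rcons (serialize ks1 H ++ B) (k, o) = serialize (rcons ks1 k) H.
  by rewrite /serialize map_rcons flatten_rcons eB rcons_cat.
move: uks; rewrite -cat_rcons cat_uniq.
case/and3P=> u1 /hasPn/(_ _ k'ks2)/= nk' u2.
rewrite eS; split=> //.
- by rewrite /serialize map_cat flatten_cat.
- by rewrite issuers_serialize // inE (negbTE nk').
- by rewrite issuers_serialize // inE k'ks2.
Qed.

(* The end order preserves real-time precedence: a transaction that starts
   after the end of [k] also ends after it. *)
Lemma is_history_opaque H : is_history H -> opaque H.
Proof.
move=> HH; have comp := complete_completion HH.
have /is_historyP HC := comp.1.
set H' := completion H in comp HC *; set S := serialize (enders H') H'.
have uE := enders_uniq HC.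
have mE k : k \in issuers H' -> k \in enders H'.
  by rewrite issuers_completion mem_enders; apply: has_end_completion.
(* Every transaction of the completion ends, hence occurs in [enders H'], so the replay drops no
   operation. *)
have opsS k : ops_of k S = ops_of k H'.
  rewrite ops_of_serialize //; case: ifPn => // /(contraNN (@mE k)).
  by rewrite mem_issuers negbK => /nilP ->.
have issS : issuers S =i issuers H' by move=> k; rewrite !mem_issuers opsS.
exists H', S; split=> //.
- apply/is_historyP/pairwise_compatibleP => k; rewrite opsS.
  by move/pairwise_compatibleP: HC.
- move=> k k'; rewrite !issS => kH k'H ne.
  have kend : has_ended k H'.
    by apply: has_end_completion; rewrite -issuers_completion.
  have k'end : has_ended k' H'.
    by apply: has_end_completion; rewrite -issuers_completion.
  move: (mE _ kH) (mE _ k'H) (uE); rewrite /S.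
  (* The position of [k'] relative to [k] in the end order decides which of the two precedes the
     other. *)
  case/splitPr=> ks1 ks2.
  rewrite mem_cat inE eq_sym (negbTE (introN eqP ne)) /=.
  case/orP=> [|k'ks2 u]; last by left; apply: prec_serialize.
  case/splitPr=> ks3 ks4; rewrite -catA => u.
  by right; apply: prec_serialize => //; rewrite mem_cat inE eqxx orbT.
- move=> k k' [H1 [o [H2 [eH eo nk' k'H2]]]].
  have k'H : k' \in issuers H'.
    by rewrite issuers_completion eH /issuers map_cat mem_cat k'H2 orbT.
  have kend : has_ended k H'.
    rewrite /H' /completion eH -cats1 !ops_of_cat !has_cat ops_of_cons eqxx /=.
    by rewrite eo !orbT.
  pose C : log := [seq (k, Abort) | k <- undup (issuers H) & live H k].
  have eE : enders H' = enders H1 ++ k :: enders (H2 ++ C).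
    rewrite /enders [H'](_ : _ = H1 ++ (k, o) :: H2 ++ C) /issuers.
      by rewrite filter_cat /= eo map_cat.
    by rewrite -cat_rcons catA -eH.
  rewrite /S eE; apply: prec_serialize => //; first by rewrite -eE.
  (* Having issued nothing up to the end of [k], [k'] is not among the transactions ended by then,
     so it comes later in the end order. *)
  have := mE _ k'H; rewrite eE -cat_rcons mem_cat => /orP[|//].
  have -> : rcons (enders H1) k = enders (rcons H1 (k, o)).
    by rewrite /enders filter_rcons eo /issuers map_rcons.
  by move: nk'; rewrite mem_issuers negbK => /nilP e; rewrite !mem_enders e.
Qed.

End Histories.

(** * Active transaction names along transitions *)

Section Semantics.

Local Open Scope fset_scope.
Local Open Scope fmap_scope.

Variables (loc : countType) (tid : choiceType) (char trname : eqType).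
Notation event := (event loc tid char trname).
Notation family := (Defs.family loc tid char trname).
Notation memory := (memory loc tid char trname).
Local Notation return_fun := (return_fun loc tid char).

Definition runs_in (P : family) k : Prop :=
  exists t T, P.[? t] = Some T /\ in_trans k T.

Definition claims (S : memory) k : Prop := exists r M, work S r = Some (M, k).

Definition only_active (A : trname -> Prop) (P : family) (S : memory) : Prop :=
  (forall k, runs_in P k -> A k) /\ (forall k, claims S k -> A k).

(** The set shrinks as the list is read: a merge retires [k], and [k <> j] ensures that its target
    stays active. *)
Fixpoint admissible (A : trname -> Prop) (es : seq event) : Prop :=
  match es with
  | [::] => True
  | ERead k _ _ :: es | EWrite k _ _ :: es => A k /\ admissible A es
  | EMerge k j :: es =>
      [/\ A k, A j, k <> j & admissible (fun i => A i /\ i <> k) es]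
  end.

Definition active_after (A : trname -> Prop) (es : seq event) :
    trname -> Prop :=
  foldl (fun A e => if e is EMerge k _ then fun i => A i /\ i <> k else A) A es.

Lemma admissible_cat A es1 es2 :
  admissible A es1 -> admissible (active_after A es1) es2 ->
  admissible A (es1 ++ es2).
Proof.
by elim: es1 A => //= -[k r M|k r M|k j] es1 IH A [] *; split=> //; apply: IH.
Qed.

Lemma active_after_cat A es1 es2 :
  active_after A (es1 ++ es2) = active_after (active_after A es1) es2.
Proof. by rewrite /active_after foldl_cat. Qed.

Lemma runs_in_set (P : family) t T k :
  runs_in P.[t <- T] k -> in_trans k T \/ runs_in P k.
Proof.
move=> [u [T' []]]; rewrite fnd_set; case: eqP => [_ [<-]|_ PT] kT.
  by left.
by right; exists u, T'.
Qed.

Lemma runs_in_set_new (P : family) t T k :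
  t \notin domf P -> runs_in P k -> runs_in P.[t <- T] k.
Proof.
move=> tP [u [T' [PT kT]]]; exists u, T'; split=> //; rewrite fnd_set.
by case: eqP => // eut; move: PT; rewrite eut not_fnd.
Qed.

Lemma runs_in_set_same (P : family) t j M N : runs_in P.[t <- InTx j M N] j.
Proof. by exists t, (InTx j M N); rewrite fnd_set eqxx. Qed.

Lemma runs_in_single t (T : thread loc tid char trname) k :
  runs_in (single t T) k -> in_trans k T.
Proof. by case/runs_in_set => // -[u [T' []]]; rewrite fnd_fmap0. Qed.

Lemma runs_in_rename (P : family) k j i :
  runs_in (rename_family k j P) i ->
  (runs_in P i /\ (k <> j -> i <> k)) \/ (runs_in P k /\ i = j).
Proof.
move=> [t [T [Pt]]]; have [tP|tP] := boolP (t \in domf P); last first.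
  by move: Pt; rewrite not_fnd.
move: Pt; rewrite in_fnd ffunE => -[<-] {T}.
case eT: (P [`tP]) => [M|k' M N] //=.
rewrite /in_trans; case: eqP => [ek|nk] ei.
  by right; split=> //; exists t, (InTx k M N); rewrite in_fnd eT ek.
left; split=> [|_]; last by rewrite -ei.
by exists t, (InTx i M N); rewrite in_fnd eT ei.
Qed.

(** This covers the threads that wait outside a sub-execution: each merge moves them from the
    retired name to its target, which stays active. *)
Lemma runs_in_rename_along A es (P : family) :
  (forall k, runs_in P k -> A k) -> admissible A es ->
  forall k, runs_in (rename_along es P) k -> active_after A es k.
Proof.
elim: es A P => [|[k r M|k r M|k j] es IH] A P PA //=.
- by case=> _ /(IH _ _ PA).
- by case=> _ /(IH _ _ PA).
case=> kA jA kj /IH; apply => i /runs_in_rename[[/PA iA nik]|[_ ->]].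
  by split=> //; apply: nik.
by split=> // /esym.
Qed.

Lemma only_active_set A (P : family) S t k M L : t \notin domf P ->
  only_active A P.[t <- InTx k M L] S <-> A k /\ only_active A P S.
Proof.
move=> tP; split=> [[PA SA]|[kA [PA SA]]].
  split; first exact/PA/runs_in_set_same.
  by split=> // i iP; apply/PA/runs_in_set_new.
by split=> // i /runs_in_set[<-|/PA].
Qed.

Lemma only_active_update A (P : family) S D r M k :
  A k -> only_active A P (set_work S D) ->
  only_active A P (set_work S (update D r (M, k))).
Proof.
move=> kA [PA SA]; split=> // i [r' [N]]; rewrite /= /update.
by case: eqP => [_ [_ <-]//|_ rN]; apply: SA; exists r', N.
Qed.

(** Threads and claims are both renamed, so nothing refers to [k] any more and it can be retired; if
    [k] equals [j], no merge is recorded and the set stays the same. *)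
Lemma only_active_merge A (P : family) S k j :
  A k -> A j -> only_active A P S ->
  [/\ admissible A (merge_event loc tid char k j),
      active_after A (merge_event loc tid char k j) j &
      only_active (active_after A (merge_event loc tid char k j))
        (rename_family k j P) (set_work S (rename_work k j (work S)))].
Proof.
move=> kA jA [PA SA]; have [ekj|/eqP nkj] := eqVneq k j.
  rewrite /merge_event ekj eqxx; split=> //; split=> i.
    by case/runs_in_rename=> [[/PA]|[_ ->]].
  case=> r [M]; rewrite /= /rename_work.
  case E: (work S r) => [[N i']|//] [_]; case: eqP => _ <- //.
  by apply: SA; exists r, N.
rewrite /merge_event (negbTE (introN eqP nkj)) /=; split=> //.
  by split=> // /esym.
split=> i.
  case/runs_in_rename=> [[/PA iA nik]|[_ ->]]; first by split=> //; apply: nik.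
  by split=> // /esym.
case=> r [M]; rewrite /= /rename_work.
case E: (work S r) => [[N i']|//] [_]; case: eqP => [_|ni'] <-.
  by split=> // /esym.
by split=> //; apply: SA; exists r, N.
Qed.

Lemma only_active_single A t k M L S :
  A k -> (forall i, claims S i -> A i) ->
  only_active A (single t (InTx k M L)) S.
Proof. by move=> kA SA; split=> // i /runs_in_single <-. Qed.

(** Quantifying over [A] inside the predicate lets the induction hypothesis for a sub-execution be
    used with the set of the enclosing state. *)
Definition preserves_active (s : state loc tid char trname) (es : seq event)
    (s' : state loc tid char trname) : Prop :=
  forall A, only_active A s.1 s.2 ->
    admissible A es /\ only_active (active_after A es) s'.1 s'.2.

(** The sub-execution has one thread but the whole memory, whose claims are bounded by the [A] of
    the enclosing state; the waiting threads [P] then undergo the same renamings. *)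
Lemma sub_execution_preserves_active A (P : family) S t k E M L es R j S' N :
  t \notin domf P -> only_active A P.[t <- InTx k M L] S ->
  preserves_active (single t (InTx k N return_fun), S) es
    (single t (InTx j R return_fun), S') ->
  admissible A es /\
  only_active (active_after A es)
    (rename_along es P).[t <- InTx j (fill E R) L] S'.
Proof.
move=> tP /(only_active_set _ _ _ _ _ tP)[kA [PA SA]].
case/(_ A (only_active_single _ _ _ kA SA)) => adm [/= P'A S'A].
have jA : active_after A es j by apply/P'A/runs_in_set_same.
by split=> //; split=> // i /runs_in_set[<-//|]; apply: runs_in_rename_along.
Qed.

(* A joint induction is needed because [orElse] and [isolated] have sub-executions as premises. *)
Scheme tau_step_mut := Minimality for tau_step Sort Prop
  with tau_steps_mut := Minimality for tau_steps Sort Prop.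

Lemma tau_step_preserves_active s es s' :
  tau_step s es s' -> preserves_active s es s'.
Proof.
move: s es s'; apply: (tau_step_mut (P0 := preserves_active)).
- move=> P S t k E M N L tP _ A /(only_active_set _ _ _ _ _ tP) PA.
  by split=> //; apply/only_active_set.
- move=> P S t k E M L t' tP t'P t't A /(only_active_set _ _ _ _ _ tP) PA.
  split=> //; apply/only_active_set.
    by rewrite mem_setf inE negb_or t't.
  by split; [case: PA|apply/only_active_set].
- move=> P S t k E M L r tP _ _ A /(only_active_set _ _ _ _ _ tP)[kA PA].
  split=> //; apply/only_active_set => //; split=> //.
  by apply: only_active_update.
- move=> P S t k E L r M tP _ _ A /(only_active_set _ _ _ _ _ tP)[kA PA].
  split=> //; apply/only_active_set => //; split=> //.
  by apply: only_active_update.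
- move=> P S t k E L r M j tP rj A /(only_active_set _ _ _ _ _ tP)[kA PA].
  (* The owner of the location is active by virtue of its claim. *)
  have jA : A j by apply: PA.2; exists r, M.
  have {}PA : only_active A P.[t <- InTx k (fill E (Return M)) L] S.
    exact/only_active_set.
  case: (only_active_merge kA jA PA) => adm jA' P'A.
  (* The access follows the merge and is issued by [j], which survives it. *)
  rewrite -cats1 active_after_cat; split=> //.
  by apply: admissible_cat.
- move=> P S t k E L r M tP _ A /(only_active_set _ _ _ _ _ tP)[kA PA].
  split=> //; apply/only_active_set => //; split=> //.
  by apply: only_active_update.
- move=> P S t k E L r M N j tP rj A /(only_active_set _ _ _ _ _ tP)[kA PA].
  have jA : A j by apply: PA.2; exists r, N.
  have {}PA : only_active A P.[t <- InTx k (fill E (Return (Unit _ _ _))) L] S.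
    exact/only_active_set.
  case: (only_active_merge kA jA PA) => adm jA' P'A.
  rewrite -cats1 active_after_cat; split; first exact: admissible_cat.
  exact: only_active_update.
- move=> P S t k E M M' L es R j S' tP _ IH _ A PA.
  exact: sub_execution_preserves_active PA IH.
(* A branch ending in [retry] is rolled back: memory is kept and no event recorded, so nothing about
   the sub-execution is used. *)
- move=> P S t k E M M' L es j S' tP _ _ A /(only_active_set _ _ _ _ _ tP) PA.
  by split=> //; apply/only_active_set.
- move=> P S t k E M L es R j S' tP _ IH _ A PA.
  exact: sub_execution_preserves_active PA IH.
- by move=> s A.
move=> s1 es1 s2 es2 s3 _ IH1 _ IH2 A /IH1[adm1 /IH2[adm2 s3A]].
by rewrite active_after_cat; split=> //; apply: admissible_cat.
Qed.

Lemma io_step_preserves_active A s l s' :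
  io_step s l s' -> only_active A s.1 s.2 -> only_active A s'.1 s'.2.
Proof.
have out P t (M N : term loc tid char) S : t \notin domf P ->
    only_active A P.[t <- OutTx _ M] S -> only_active A P.[t <- OutTx _ N] S.
  move=> tP [PA SA]; split=> // i /runs_in_set[//|iP].
  exact/PA/runs_in_set_new.
case=> {s l s'} /=; try by move=> *; apply: out; eauto.
move=> P S t E M t' tP t'P t't PA.
have [{}PA SA] := out _ _ _ (fill E (Return (ThreadRef _ _ t'))) _ tP PA.
by split=> // i /runs_in_set[//|/PA].
Qed.

(** * Starts, commits and aborts of transactions *)

Lemma runs_in_add (P Q : family) i :
  runs_in (P + Q)%fset i -> runs_in P i \/ runs_in Q i.
Proof.
move=> [t [T []]]; rewrite fnd_cat; case: ifP => _ tT iT.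
  by right; exists t, T.
by left; exists t, T.
Qed.

Lemma runs_in_addl (P Q : family) i : [disjoint domf P & domf Q]%fset ->
  runs_in P i -> runs_in (P + Q)%fset i.
Proof.
move=> dPQ [t [T [tT iT]]]; exists t, T; split=> //.
have tP : t \in domf P by apply: contraPT tT => /not_fnd ->.
by rewrite fnd_cat (negbTE (fdisjointP dPQ _ tP)).
Qed.

Lemma runs_in_addr (P Q : family) i :
  runs_in Q i -> runs_in (P + Q)%fset i.
Proof.
move=> [t [T [tT iT]]]; exists t, T; split=> //.
have tQ : t \in domf Q by apply: contraPT tT => /not_fnd ->.
by rewrite fnd_cat tQ.
Qed.

Definition is_new (b : mlabel loc tid char trname) : bool :=
  if b is New _ then true else false.

(** No thread stays behind in a transaction that commits or aborts: parts composed by [mstep_par_co]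
    or [mstep_par_ab] act together, and [mstep_par] demands that the idle part has no thread in
    it. *)
Lemma mstep_runs_in s b s' : mstep s b s' -> forall i, runs_in s'.1 i ->
  if is_new b then i = label_trans b \/ runs_in s.1 i
  else runs_in s.1 i /\ i <> label_trans b.
Proof.
elim=> {s b s'} /=; try by move=> *; match goal with H : runs_in _ _ |- _ =>
  move/runs_in_single: H => // end.
- by move=> S t M N k i /runs_in_single ->; left.
- move=> P Q P' Q' S S' k t M dPQ _ IHP _ IHQ i /runs_in_add[/IHP|/IHQ] [iP ni].
    by split=> //; apply: runs_in_addl.
  by split=> //; apply: runs_in_addr.
- move=> P Q P' Q' S S' k dPQ _ IHP _ IHQ i /runs_in_add[/IHP|/IHQ] [iP ni].
    by split=> //; apply: runs_in_addl.
  by split=> //; apply: runs_in_addr.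
move=> P Q P' S S' b dPQ _ IHP nQ i /runs_in_add[/IHP|iQ].
  case: is_new => [[->|]|[]]; [by left|right|split=> //]; exact: runs_in_addl.
case: is_new; first by right; apply: runs_in_addr.
split; first exact: runs_in_addr.
by move=> ei; case: iQ => t [T [tT]]; rewrite ei; apply: nQ tT.
Qed.

(** This makes the issuer of a recorded commit or abort active at that moment. *)
Lemma mstep_runs_in_label s b s' :
  mstep s b s' -> ~~ is_new b -> runs_in s.1 (label_trans b).
Proof.
elim=> {s b s'} //=; try by move=> *; apply: runs_in_set_same.
- by move=> P Q P' Q' S S' k t M dPQ _ IHP _ _ /IHP; apply: runs_in_addl.
- by move=> P Q P' Q' S S' k dPQ _ IHP _ _ /IHP; apply: runs_in_addl.
- by move=> P Q P' S S' b dPQ _ IHP _ /IHP; apply: runs_in_addl.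
Qed.

Lemma mstep_work s b s' : mstep s b s' ->
  work s'.2 = if is_new b then work s.2 else cleanup (label_trans b) s.2.
Proof. by elim. Qed.

Lemma mstep_end_only_active A s b s' : mstep s b s' -> ~~ is_new b ->
  only_active A s.1 s.2 ->
  only_active (fun i => A i /\ i <> label_trans b) s'.1 s'.2.
Proof.
move=> st /negbTE nb [PA SA]; split=> i.
  by move/(mstep_runs_in st); rewrite nb => -[/PA].
case=> r [M]; rewrite (mstep_work st) nb /cleanup.
case E: (work s.2 r) => [[N i']|//]; case: eqP => // ni' [_ <-].
by split=> //; apply: SA; exists r, N.
Qed.

Lemma mstep_new_only_active A s b s' : mstep s b s' -> is_new b ->
  only_active A s.1 s.2 ->
  only_active (fun i => i = label_trans b \/ A i) s'.1 s'.2.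
Proof.
move=> st nb [PA SA]; split=> i.
  by move/(mstep_runs_in st); rewrite nb => -[->|/PA]; [left|right].
by rewrite /claims (mstep_work st) nb => /SA; right.
Qed.

End Semantics.

(** * Well-formedness of the histories that describe executions *)

Section Described.

Variables (loc : countType) (tid : choiceType) (char trname : eqType).
Notation op := (op loc tid char trname).
Notation log := (log loc tid char trname).
Implicit Types (H : log) (inc : trname -> nat) (A : trname -> Prop).

(* [k] has neither ended nor merged in its current incarnation. *)
Definition active H inc k : bool :=
  all (fun o : op => ~~ is_end o && ~~ is_prepare o) (ops_of (k, inc k) H).

(** The invariant on logs, tied to [only_active] by sharing the set [A]. The bound on incarnations
    makes a newly started transaction fresh. *)
Definition well_recorded A inc H : Prop :=
  [/\ pairwise (@compatible _ _ _ _) H,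
      forall k n, (k, n) \in issuers H -> n <= inc k
    & forall k, A k -> active H inc k].

Lemma pairwise_compatible_rcons H inc k o :
  active H inc k -> pairwise (@compatible _ _ _ _) H ->
  pairwise (@compatible _ _ _ _) (rcons H ((k, inc k), o)).
Proof.
move=> ak HH; rewrite pairwise_rcons HH andbT.
move: ak; rewrite /active /ops_of all_map all_filter; apply: sub_all => e /=.
rewrite /compatible /=; case: eqP => //= _ /andP[ne np].
by rewrite /may_precede ne (negbTE np).
Qed.

Lemma issuers_rcons_le H inc k o :
  (forall i n, (i, n) \in issuers H -> n <= inc i) ->
  forall i n, (i, n) \in issuers (rcons H ((k, inc k), o)) -> n <= inc i.
Proof.
move=> Hinc i n; rewrite /issuers map_rcons mem_rcons inE.
by case/orP=> [/eqP[-> ->]|/Hinc].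
Qed.

Lemma active_rcons_other H inc k o i :
  i <> k -> active (rcons H ((k, inc k), o)) inc i = active H inc i.
Proof.
move=> nik; rewrite /active -cats1 ops_of_cat ops_of_cons /= xpair_eqE.
by rewrite eq_sym (negbTE (introN eqP nik)) cats0.
Qed.

Lemma well_recorded_access A inc H k o :
  ~~ is_end o -> ~~ is_prepare o -> A k -> well_recorded A inc H ->
  well_recorded A inc (rcons H ((k, inc k), o)).
Proof.
move=> ne np kA [HH Hinc HA]; split.
- by apply: pairwise_compatible_rcons => //; apply: HA.
- exact: issuers_rcons_le.
move=> i /HA; case: (eqVneq i k) => [->|/eqP nik].
  rewrite /active -cats1 ops_of_cat ops_of_cons eqxx all_cat => -> /=.
  by rewrite ne np.
by rewrite active_rcons_other.
Qed.

(** As [o] is arbitrary, this serves commits, aborts and the prepare of a merge alike. *)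
Lemma well_recorded_last A inc H k o : A k -> well_recorded A inc H ->
  well_recorded (fun i => A i /\ i <> k) inc (rcons H ((k, inc k), o)).
Proof.
move=> kA [HH Hinc HA]; split.
- by apply: pairwise_compatible_rcons => //; apply: HA.
- exact: issuers_rcons_le.
by move=> i [/HA iA nik]; rewrite active_rcons_other.
Qed.

Lemma well_recorded_events A inc H es H' :
  record_events inc H es H' -> admissible A es -> well_recorded A inc H ->
  well_recorded (active_after A es) inc H'.
Proof.
move=> rec; elim: rec A => {H es H'} //=.
- move=> H k r M es H' _ IH A [kA /IH] + HA; apply.
  exact: well_recorded_access.
- move=> H k r M es H' _ IH A [kA /IH] + HA; apply.
  exact: well_recorded_access.
move=> H k j n M es H' _ _ IH A [kA jA nkj /IH] + HA; apply.
(* Of the three entries of a merge, the write by [j] and the read by [k] are plain accesses, and the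
   prepare retires [k]. *)
rewrite -cat_rcons -cat_rcons cats1; apply: well_recorded_last => //.
by do 2!apply: well_recorded_access => //.
Qed.

(** Recorded incarnations of [k] are at most [inc k], so the next one has issued nothing and is
    active whatever the earlier ones did. *)
Lemma well_recorded_new A inc H k : well_recorded A inc H ->
  well_recorded (fun i => i = k \/ A i)
    (fun i => if i == k then (inc i).+1 else inc i) H.
Proof.
move=> [HH Hinc HA]; split=> //.
  by move=> i n /Hinc; case: ifP => // _ /leqW.
move=> i; rewrite /active; case: eqVneq => [->|nik [ei|/HA //]].
  suff /nilP -> : nilp (ops_of (k, (inc k).+1) H) by [].
  by rewrite -[nilp _]negbK -mem_issuers; apply/negP => /Hinc; rewrite ltnn.
by rewrite ei eqxx in nik.
Qed.

Lemma execution_rconsE (s0 : state loc tid char trname) acts a s :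
  execution s0 (rcons acts a) s ->
  exists s1, execution s0 acts s1 /\ step s1 a s.
Proof.
move: {-1}(rcons acts a) (erefl (rcons acts a)) => l el ex.
case: ex el => [|acts' s1 a' s' ex st]; first by case: acts.
by move/rcons_inj=> [-> ->]; exists s1.
Qed.

Lemma well_recorded_end A inc H (s : state loc tid char trname) b s' o :
  mstep s b s' -> ~~ is_new b -> only_active A s.1 s.2 ->
  well_recorded A inc H ->
  exists2 A', only_active A' s'.1 s'.2 &
    well_recorded A' inc
      (rcons H ((label_trans b, inc (label_trans b)), o)).
Proof.
move=> st nb sA HA; exists (fun i => A i /\ i <> label_trans b).
  exact: mstep_end_only_active sA.
apply: well_recorded_last => //; apply: sA.1.
exact: mstep_runs_in_label st nb.
Qed.

(** The set [A] couples state and log through the induction: merges, commits and aborts remove names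
    from it, and [New] adds one. *)
Lemma described_well_recorded t (M : term loc tid char) acts inc H s :
  describes acts inc H -> execution (init trname t M) acts s ->
  exists2 A, only_active A s.1 s.2 & well_recorded A inc H.
Proof.
move=> d; elim: d s => {acts inc H}.
(* Initially no thread is in a transaction and no location is claimed, so the empty set works. *)
- move=> s ex; exists (fun _ => False); last by split.
  have -> : s = init trname t M.
    inversion ex as [|acts a s1 s2 ex1 st1 nil_rcons] => //.
    by case: acts nil_rcons {ex1}.
  by split=> k; [move/runs_in_single|case=> r []].
- move=> acts inc H l _ IH s /execution_rconsE[s1 [/IH[A s1A HA] st]].
  have {st} st : io_step s1 l s by inversion st.
  by exists A => //; apply: io_step_preserves_active st s1A.
- move=> acts inc H es H' _ IH rec s /execution_rconsE[s1 [/IH[A s1A HA] st]].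
  have {st} st : tau_step s1 es s by inversion st.
  have [adm sA] := tau_step_preserves_active st s1A.
  by exists (active_after A es) => //; apply: well_recorded_events rec _ _.
- move=> acts inc H k _ IH s /execution_rconsE[s1 [/IH[A s1A HA] st]].
  have {st} st : mstep s1 (New _ _ _ k) s by inversion st.
  exists (fun i => i = k \/ A i); first exact: mstep_new_only_active st _ s1A.
  exact: well_recorded_new.
- move=> acts inc H k _ IH s /execution_rconsE[s1 [/IH[A s1A HA] st]].
  have {st} st : mstep s1 (Co _ _ _ k) s by inversion st.
  exact: (well_recorded_end _ st isT s1A HA).
- move=> acts inc H k u N _ IH s /execution_rconsE[s1 [/IH[A s1A HA] st]].
  have {st} st : mstep s1 (Ab k u N) s by inversion st.
  exact: (well_recorded_end _ st isT s1A HA).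
- move=> acts inc H k u N _ IH s /execution_rconsE[s1 [/IH[A s1A HA] st]].
  have {st} st : mstep s1 (AbBar k u N) s by inversion st.
  exact: (well_recorded_end _ st isT s1A HA).
Qed.

End Described.

Theorem corollary4p5 :
  forall (loc : countType) (tid : choiceType) (char trname : eqType)
         (M : term loc tid char) (H : log loc tid char trname),
    otm_program M -> history_of_program M H -> opaque H.
Proof.
move=> loc tid char trname M H _ [t [acts [s [inc [ex d]]]]].
have [A _ [HH _ _]] := described_well_recorded d ex.
exact/is_history_opaque/is_historyP.
Qed.
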